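(* Let $G$ be a collectionwise Hausdorff $T_1$ paratopological group with a closed suitable set $S$ and let $H$ be a sequentially dense subgroup of $G$. Then $H$ has a closed suitable set of size at most $|S|\cdot\aleph_0$.
   Context: A paratopological group is a group $G$ endowed with a topology such that the group operation $G\times G\to G$ is continuous (inversion need not be continuous). The identity is denoted by $e$. A subset $S$ of a paratopological group $G$ is a suitable set for $G$ if $S$ is a discrete subspace of $G$, $S\cup\{e\}$ is closed in $G$, and the subgroup $\langle S\rangle$ generated by $S$ is dense in $G$. A closed suitable set for a group is a suitable set that is closed in that group. Subgroups carry the subspace topology. A subset $D$ of a space $X$ is strongly discrete if each point $x\in D$ has a neighborhood $U_x$ such that the family $\{U_x:x\in D\}$ is discrete, that is, each point of $X$ has a neighborhood intersecting at most one set of the family. A space is collectionwise Hausdorff if each of its closed discrete subsets is strongly discrete. A subset $D$ of a space $X$ is sequentially dense (in $X$) if each point $x\in X$ is a limit of a sequence of points of $D$. *)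

(* Defs.v *)
From HB Require Import structures.
From mathcomp Require Import all_boot all_order all_algebra.
From mathcomp Require Import all_classical all_reals all_analysis.

Set Implicit Arguments.
Unset Strict Implicit.
Unset Printing Implicit Defensive.

Local Open Scope classical_set_scope.
Local Open Scope group_scope.

HB.mixin Record isParatopologicalGroup G of Group G & Topological G := {
  mulg_continuous : continuous (fun xy : G * G => xy.1 * xy.2)
}.

#[short(type="paratopologicalGroupType")]
HB.structure Definition ParatopologicalGroup :=
  {G of Group G & Topological G & isParatopologicalGroup G}.

(* A subgroup of G is a [groupClosed G]; as a type it carries the restricted
   group law and the subspace topology. *)
Definition subgroup_type (G : groupType) (H : groupClosed G) : Type :=
  {x : G | x \in H}.

Section SubgroupGroup.
Variables (G : groupType) (H : groupClosed G).

Let subgroup_closed : group_closed (fun x : G => x \in H).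
Proof. by split=> [|x y]; [exact: gpred1 | exact: gpredF]. Qed.

HB.instance Definition _ := SubChoice.on (subgroup_type H).
HB.instance Definition _ :=
  SubChoice_isSubGroup.Build G (fun x => x \in H) (subgroup_type H)
    subgroup_closed.

End SubgroupGroup.

Section SubgroupTopology.
Variables (G : paratopologicalGroupType) (H : groupClosed G).

HB.instance Definition _ := Topological.copy (subgroup_type H)
  (initial_topology (val : subgroup_type H -> G)).

Let subgroup_mulg_continuous :
  continuous (fun xy : subgroup_type H * subgroup_type H => xy.1 * xy.2).
Proof.
have valc : continuous (val : subgroup_type H -> G).
  exact: (@initial_continuous _ _ (val : subgroup_type H -> G)).
apply: (@continuous_comp_initial (subgroup_type H) _ G val) => -[x y].
apply: (@continuous_comp _ _ _
  (fun xy : subgroup_type H * subgroup_type H => (val xy.1, val xy.2))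
  (fun xy : G * G => xy.1 * xy.2)); last exact: mulg_continuous.
by apply: cvg_pair; [apply: (cvg_comp fst val); [exact: cvg_fst|exact: valc]
                    |apply: (cvg_comp snd val); [exact: cvg_snd|exact: valc]].
Qed.

HB.instance Definition _ := isParatopologicalGroup.Build (subgroup_type H)
  subgroup_mulg_continuous.

End SubgroupTopology.

Definition generated_subgroup (G : groupType) (S : set G) : set G :=
  smallest [set A : set G | group_closed [in A]] S.

Definition discrete_subspace (T : topologicalType) (D : set T) : Prop :=
  forall A : set (set_type D), open A.

Definition suitable_set (G : paratopologicalGroupType) (S : set G) : Prop :=
  [/\ discrete_subspace S, closed (S `|` [set 1])
    & dense (generated_subgroup S)].

Definition closed_suitable_set (G : paratopologicalGroupType) (S : set G) :
  Prop := suitable_set S /\ closed S.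

(* The family {U x : x in D} is indexed by D: a set occurring for two distinct
   indices counts twice, as otherwise U := fun=> setT would always do. *)
Definition discrete_family (T : topologicalType) (I : Type) (D : set I)
    (U : I -> set T) : Prop :=
  forall y : T, exists2 V, nbhs y V &
    forall i j, D i -> D j -> V `&` U i !=set0 -> V `&` U j !=set0 -> i = j.

Definition strongly_discrete (T : topologicalType) (D : set T) : Prop :=
  exists2 U : T -> set T, (forall x, D x -> nbhs x (U x)) & discrete_family D U.

Definition collectionwise_hausdorff (T : topologicalType) : Prop :=
  forall D : set T, closed D -> discrete_subspace D -> strongly_discrete D.

Definition sequentially_dense (T : topologicalType) (D : set T) : Prop :=
  forall x : T, exists2 u : nat -> T, (forall n, D (u n)) & u @ \oo --> x.

(* Main.v *)
(** The union over x in S of sequences of H converging to x need not generate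
    a dense subgroup, since inversion is not continuous and the closure of a
    subgroup is only a submonoid.  Along with u_n -> x we therefore take
    v_n -> x^-1 in H and put u_n and w_n = u_n v_n u_n -> x in the set: then
    v_n = u_n^-1 w_n u_n^-1 lies in the generated subgroup, whose closure thus
    contains both x and x^-1.  When x already lies in H the sequences are
    constant; otherwise they have no accumulation point in H.  Collectionwise
    Hausdorffness allows the sequences to be confined to a discrete family of
    neighborhoods of the points of S, and makes G Hausdorff, so that a
    convergent sequence accumulates only at its limit. *)
Require Import Defs.
From HB Require Import structures.
From mathcomp Require Import all_boot all_order all_algebra.
From mathcomp Require Import all_classical all_reals all_analysis.

Local Open Scope classical_set_scope.
Local Open Scope card_scope.

(** The point [y] need not lie in [D]. Required at every [y] of the space, the condition says that
    [D] has no accumulation point, so closedness and discreteness follow from one local check. *)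
Definition isolated_at {T : topologicalType} (D : set T) (y : T) : Prop :=
  exists2 W, nbhs y W & W `&` D `<=` [set y].

Lemma isolated_closed {T : topologicalType} (D : set T) :
  (forall y, isolated_at D y) -> closed D.
Proof.
move=> Dy y Dcly; have [W yW WD] := Dy y.
by have [z [Dz Wz]] := Dcly _ yW; rewrite -(WD z).
Qed.

Lemma isolated_discrete {T : topologicalType} (D : set T) :
  (forall y, isolated_at D y) -> discrete_subspace D.
Proof.
move=> Dy A; rewrite openE => z Az; have [W zW WD] := Dy (val z).
have : nbhs z (set_val @^-1` W).
  exact: (@initial_continuous _ _ (set_val : D -> T)).
apply: filterS => w Ww; suff -> : w = z by [].
by apply/val_inj/WD; split=> //; exact: set_valP.
Qed.

Lemma isolated_at_finite {T : topologicalType} (F : set T) (y : T) :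
  accessible_space T -> finite_set F -> isolated_at F y.
Proof.
move=> T1 finF; exists (~` (F `\ y)); last first.
  by move=> z [nFz Fz]; apply: contrapT => zy; exact: nFz.
apply: open_nbhs_nbhs; split; last by case=> _; apply.
rewrite openC; apply: (accessible_finite_set_closed.1 T1).
exact: finite_setD.
Qed.

(** Separate [x] from [y] by disjoint open sets [A] and [B]. All but finitely many terms lie in [A],
    hence outside [B], and a finite set is isolated at [y] by T1. *)
Lemma isolated_at_cvg {T : topologicalType} (t : nat -> T) (x y : T) :
  accessible_space T -> hausdorff_space T -> t @ \oo --> x -> x != y ->
  isolated_at (range t) y.
Proof.
move=> T1 T2 tx xy; move: T2; rewrite open_hausdorff => /(_ _ _ xy).
move=> [[A B] /= [/set_mem Ax /set_mem By] [oA oB /eqP AB0]].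
have [N _ NA] := tx _ (open_nbhs_nbhs (conj oA Ax)).
have [W yW WF] : isolated_at (t @` `I_N) y.
  by apply: isolated_at_finite => //; exact/finite_image/finite_II.
exists (W `&` B); first by apply: filterI => //; exact: open_nbhs_nbhs.
move=> z [[Wt Bt] [n _ tz]]; subst z; have [nN|Nn] := ltnP n N.
  by apply: WF; split=> //; exists n.
have: (A `&` B) (t n) by split=> //; exact: NA.
by rewrite AB0.
Qed.

(** A pair of points is closed and discrete in a T1 space. If its neighborhoods met at [z], every
    neighborhood of [z] would meet both, and discreteness of the family would identify the two
    points. *)
Lemma cwHausdorff_hausdorff {T : topologicalType} :
  accessible_space T -> collectionwise_hausdorff T -> hausdorff_space T.
Proof.
move=> T1 cwH x y xy; apply: contrapT => xDy.
have iso z : isolated_at [set x; y] z.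
  by apply: isolated_at_finite => //; exact: finite_set2.
have [U nU dU] := cwH _ (isolated_closed _ iso) (isolated_discrete _ iso).
have Ux : nbhs x (U x) by apply: nU; left.
have Uy : nbhs y (U y) by apply: nU; right.
have [z [Uxz Uyz]] := xy _ _ Ux Uy.
have [V zV VU] := dU z.
apply: xDy; apply: VU; [by left|by right| |];
  by exists z; split=> //; exact: nbhs_singleton.
Qed.

Lemma closure_seq {T : topologicalType} (A : set T) (v : nat -> T) (y : T) :
  (forall n, A (v n)) -> v @ \oo --> y -> closure A y.
Proof.
move=> Av vy B /vy [N _ NB]; exists (v N).
by split; [exact: Av | exact: (NB N (leqnn N))].
Qed.

Lemma cvg_mulg {G : paratopologicalGroupType} (u v : nat -> G) (x y : G) :
  u @ \oo --> x -> v @ \oo --> y -> (fun n => u n * v n)%g @ \oo --> (x * y)%g.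
Proof.
move=> ux vy.
exact: (cvg_comp _ _ (cvg_pair ux vy) (@mulg_continuous G (x, y))).
Qed.

Lemma closure_mulg {G : paratopologicalGroupType} (A : set G) (x y : G) :
  (forall a b, A a -> A b -> A (a * b)%g) ->
  closure A x -> closure A y -> closure A (x * y)%g.
Proof.
move=> AM Ax Ay B xyB.
have [[V W] /= [xV yW] VWB] := @mulg_continuous G (x, y) _ xyB.
have [a [Aa Va]] := Ax _ xV; have [b [Ab Wb]] := Ay _ yW.
by exists (a * b)%g; split; [exact: AM | exact: (VWB (a, b))].
Qed.

Lemma generated_subgroup_closed {G : groupType} (S : set G) :
  group_closed [in generated_subgroup S].
Proof.
split; first by apply/mem_set => A [[/set_mem]].
move=> x y /set_mem Sx /set_mem Sy; apply/mem_set => A [[A1 AV] SA].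
by apply/set_mem/AV; apply/mem_set; [exact: Sx | exact: Sy].
Qed.

Lemma generated_subgroupP {G : groupType} (S : set G) (x y : G) :
  generated_subgroup S x -> generated_subgroup S y ->
  generated_subgroup S (x / y)%g.
Proof.
have [_ SV] := generated_subgroup_closed S.
by move=> Sx Sy; apply/set_mem/SV; exact/mem_set.
Qed.

Lemma generated_subgroup1 {G : groupType} (S : set G) :
  generated_subgroup S 1%g.
Proof. by have [/set_mem] := generated_subgroup_closed S. Qed.

Lemma generated_subgroupV {G : groupType} (S : set G) (x : G) :
  generated_subgroup S x -> generated_subgroup S x^-1%g.
Proof.
by rewrite -div1g; apply: generated_subgroupP; exact: generated_subgroup1.
Qed.

Lemma generated_subgroupM {G : groupType} (S : set G) (x y : G) :
  generated_subgroup S x -> generated_subgroup S y ->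
  generated_subgroup S (x * y)%g.
Proof.
move=> Sx /generated_subgroupV Sy; rewrite -(invgK y).
exact: generated_subgroupP.
Qed.

Lemma generated_sub_closure {G : paratopologicalGroupType} (S A : set G) :
  group_closed [in A] ->
  (forall x, S x -> closure A x /\ closure A x^-1%g) ->
  generated_subgroup S `<=` closure A.
Proof.
move=> [/set_mem A1 AV] SA.
have AF a b : A a -> A b -> A (a / b)%g.
  by move=> Aa Ab; apply/set_mem/AV; exact/mem_set.
have AM a b : A a -> A b -> A (a * b)%g.
  move=> Aa Ab; rewrite -(invgK b).
  by apply: (AF) => //; rewrite -div1g; exact: AF.
(* The closure of [A] is only a submonoid; its elements whose inverse also lies in it form a
   subgroup. *)
suff : generated_subgroup S `<=` [set x | closure A x /\ closure A x^-1%g].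
  by move=> SC x /SC[].
apply: smallest_sub => //; split.
  by apply/mem_set; rewrite /= invg1; split; exact: subset_closure.
move=> x y /set_mem[Ax Ax'] /set_mem[Ay Ay']; apply/mem_set; split => /=.
  exact: closure_mulg.
by rewrite invgF; exact: closure_mulg.
Qed.

Lemma valM {G : groupType} {H : groupClosed G} (x y : subgroup_type H) :
  val (x * y)%g = (val x * val y)%g.
Proof. by []. Qed.

Lemma seq_dense_lift {G : paratopologicalGroupType} {H : groupClosed G}
    (x : G) :
  sequentially_dense [set x : G | x \in H] ->
  exists2 u : nat -> subgroup_type H, (fun n => val (u n)) @ \oo --> x &
    x \in H -> forall n, val (u n) = x.
Proof.
move=> hH; have [xH|xH] := boolP (x \in H).
  by exists (fun=> Sub x xH) => //=; exact: cvg_cst.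
have [u uH ux] := hH x.
by exists (fun n => Sub (u n) (uH n)).
Qed.

Lemma approximating_seq {G : paratopologicalGroupType} {H : groupClosed G}
    (x : G) (U : set G) :
  sequentially_dense [set x : G | x \in H] -> nbhs x U ->
  exists t : nat -> subgroup_type H,
    [/\ forall n, U (val (t n)), (fun n => val (t n)) @ \oo --> x,
        x \in H -> forall n, val (t n) = x &
        forall T, range t `<=` T ->
          closure (val @` generated_subgroup T) x^-1%g].
Proof.
move=> hH xU.
have [u ux uc] := seq_dense_lift x hH.
have [v vx vc] := seq_dense_lift x^-1%g hH.
pose w n := (u n * v n * u n)%g.
have wx : (fun n => val (w n)) @ \oo --> x.
  have := cvg_mulg _ _ _ _ (cvg_mulg _ _ _ _ ux vx) ux.
  by rewrite mulgV mul1g.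
have uw V : nbhs x V ->
    exists N, forall n, (N <= n)%N -> V (val (u n)) /\ V (val (w n)).
  move=> xV; have [N _ NV] := ux _ xV; have [M _ MV] := wx _ xV.
  exists (maxn N M) => n; rewrite geq_max => /andP[Nn Mn].
  by split; [exact: NV | exact: MV].
have [N NU] := uw _ xU.
(* Interleave [u] (even places) with [w] (odd places); the shift by [N] keeps every term in [U]. *)
exists (fun n => if odd n then w (N + n./2)%N else u (N + n./2)%N); split.
- by move=> n; have [Uu Uw] := NU _ (leq_addr n./2 N); case: ifP.
- move=> V /uw [M MV]; exists M.*2 => // n /= Mn.
  have /MV[Vu Vw] : (M <= N + n./2)%N.
    by rewrite (leq_trans _ (leq_addl _ _)) // -(doubleK M) half_leq.
  by case: ifP.
- move=> xH n; case: ifP => _; last exact: uc.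
  by rewrite !valM uc // vc ?gpredV // mulgV mul1g.
move=> T tT; apply: (@closure_seq _ _ (fun n => val (v (N + n)%N))).
  move=> n; exists (v (N + n)%N) => //.
  have Tu : generated_subgroup T (u (N + n)%N).
    apply: sub_gen_smallest; apply: tT; exists n.*2 => //.
    by rewrite odd_double doubleK.
  have Tw : generated_subgroup T (w (N + n)%N).
    apply: sub_gen_smallest; apply: tT; exists n.*2.+1 => //.
    by rewrite /= odd_double /= uphalf_double.
  have -> : v (N + n)%N = ((u (N + n)%N)^-1 * (w (N + n)%N / u (N + n)%N))%g.
    by rewrite /w mulgK mulKg.
  apply: generated_subgroupM; first exact: generated_subgroupV.
  exact: generated_subgroupP.
move=> V /vx [M _ MV]; exists M => // n /= Mn.
by apply: MV => /=; exact: leq_trans Mn (leq_addl _ _).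
Qed.

Theorem proposition5p4 (G : paratopologicalGroupType)
  (hT1 : accessible_space G) (hcwH : collectionwise_hausdorff G)
  (S : set G) (hS : closed_suitable_set S)
  (H : groupClosed G) (hH : sequentially_dense [set x : G | x \in H]) :
  exists T : set (subgroup_type H),
    closed_suitable_set T /\ T #<= S `*` [set: nat].
Proof.
have [[dS _ denS] cS] := hS.
have T2 := cwHausdorff_hausdorff hT1 hcwH.
have [U nU dU] := hcwH S cS dS.
have /choice[t tP] : forall x, exists t : nat -> subgroup_type H, S x ->
    [/\ forall n, U x (val (t n)), (fun n => val (t n)) @ \oo --> x,
        x \in H -> forall n, val (t n) = x &
        forall T, range t `<=` T ->
          closure (val @` generated_subgroup T) x^-1%g].
  (* Outside [S] the sequence is a dummy: [T] only uses indices in [S]. *)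
  move=> x; have [Sx|Sx] := pselect (S x); last by exists (fun=> 1%g).
  by have [t] := approximating_seq x _ hH (nU _ Sx); exists t.
pose T := (fun p => t p.1 p.2) @` (S `*` [set: nat]).
exists T; split; last exact: card_image_le.
have valc : continuous (val : subgroup_type H -> G).
  exact: (@initial_continuous _ _ (val : subgroup_type H -> G)).
have isoT y : isolated_at T y.
  have [V yV VU] := dU (val y).
  have [[x [Sx [z [Vz Uz]]]]|noS] :=
    pselect (exists x, S x /\ V `&` U x !=set0); last first.
    (* Each sequence [t x] stays in [U x], so a [V] that meets no [U x] misses [T]. *)
    exists (val @^-1` V); first exact: valc.
    move=> z [Vt [[x n] /= [Sx _] tz]]; subst z; exfalso; apply: noS.
    by exists x; split=> //; exists (val (t x n)); split=> //; case: (tP _ Sx).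
  have [_ tx tc _] := tP _ Sx.
  have [W yW Wt] : isolated_at (range (fun n => val (t x n))) (val y).
    (* If [x] is the point [y] itself, then [x] lies in [H] and its sequence is constant, so any
       neighborhood will do. *)
    have [xy|xy] := eqVneq x (val y); last exact: isolated_at_cvg tx xy.
    exists setT; first exact: filterT.
    move=> _ [_ [n _ <-]]; rewrite /= -xy; apply: tc; rewrite xy.
    exact: valP.
  exists (val @^-1` (V `&` W)); first by apply: valc; exact: filterI.
  move=> s [[Vt Wt'] [[x' n] /= [Sx' _] tz]]; subst s.
  (* [V] meets both [U x'] and [U x], so near [y] only the sequence of [x] contributes to [T]. *)
  have x'x : x' = x.
    apply: VU => //; last by exists z.
    by exists (val (t x' n)); split=> //; case: (tP _ Sx').
  by rewrite x'x in Vt Wt' *; apply/val_inj/Wt; split=> //; exists n.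
have cT := isolated_closed _ isoT.
have tT x : S x -> range (t x) `<=` T.
  by move=> Sx _ [n _ <-]; exists (x, n).
split=> //; split; first exact: isolated_discrete.
  apply: closedU => //.
  have -> : [set 1%g] = val @^-1` [set 1%g] :> set (subgroup_type H).
    by apply/seteqP; split=> z /= => [-> //|z1]; exact: val_inj.
  apply: preimage_closed => [z _|]; first exact: valc.
  exact: accessible_closed_set1.
(* Density is checked in [G], as points of [S] may lie outside [H]: an open [V] with trace [O] meets
   the subgroup generated by [S], which lies in the closure of the image of the one generated by
   [T]. *)
move=> O [y Oy] oO; case: oO Oy => V oV <- Vy.
have [g [Vg Sg]] := denS V (ex_intro _ (val y) Vy) oV.
have gA : group_closed [in val @` generated_subgroup T].
  split; first by apply/mem_set; exists 1%g => //; exact: generated_subgroup1.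
  move=> _ _ /set_mem[a Ta <-] /set_mem[b Tb <-]; apply/mem_set.
  by exists (a / b)%g => //; exact: generated_subgroupP.
have SA x : S x -> closure (val @` generated_subgroup T) x /\
                   closure (val @` generated_subgroup T) x^-1%g.
  move=> Sx; have [_ tx _ xV] := tP _ Sx; split; last exact/xV/tT.
  apply: closure_seq tx => n; exists (t x n) => //.
  by apply: sub_gen_smallest; apply: (tT _ Sx); exists n.
have [_ [[h Th <-] Vh]] :=
  generated_sub_closure _ _ gA SA g Sg V (open_nbhs_nbhs (conj oV Vg)).
by exists h.
Qed.
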